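(* Let $p$ and $q$ be terms in the language $\langle \vee,\wedge,{}^{*},0,1\rangle$ of QB-algebras. Then the identity $p\approx q$ holds in every flat QB-algebra if and only if $p\approx q$ holds in the algebra $\mathbf{F}_3$.
   Context: A quasi-lattice is an algebra $\langle L;\vee,\wedge\rangle$ such that for all $x,y,z$: $\vee,\wedge$ are commutative and associative; $x\vee(x\wedge y)=x\vee x$ and $x\wedge(x\vee y)=x\wedge x$; $x\vee(y\vee y)=x\vee y$ and $x\wedge(y\wedge y)=x\wedge y$; $x\vee x=x\wedge x$. It is distributive if $x\vee(y\wedge z)=(x\vee y)\wedge(x\vee z)$ and $x\wedge(y\vee z)=(x\wedge y)\vee(x\wedge z)$. A quasi-Boolean algebra (QB-algebra) is an algebra $\langle Q;\vee,\wedge,{}^{*},0,1\rangle$ of type $\langle 2,2,1,0,0\rangle$ such that $\langle Q;\vee,\wedge\rangle$ is a distributive quasi-lattice and for all $x$: $x\vee 1=1$, $x\wedge 0=0$, $x\vee x^{*}=1$, $x\wedge x^{*}=0$, $(x\wedge x)^{*}=x^{*}\vee x^{*}$, $x^{**}=x$. A QB-algebra is flat if it satisfies $1=0$. $\mathbf{F}_3$ is the flat QB-algebra with universe $\{0,c,d\}$, $1=0$, $x\vee y=x\wedge y=0$ for all $x,y$, and $0^{*}=0$, $c^{*}=d$, $d^{*}=c$. *)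

(* Defs.v *)
From mathcomp Require Import ssreflect ssrfun.

Set Implicit Arguments.
Unset Strict Implicit.
Unset Printing Implicit Defensive.

Record quasi_lattice (T : Type) (join meet : T -> T -> T) : Prop := QuasiLattice {
  ql_joinC : commutative join;
  ql_meetC : commutative meet;
  ql_joinA : associative join;
  ql_meetA : associative meet;
  ql_join_meet : forall x y, join x (meet x y) = join x x;
  ql_meet_join : forall x y, meet x (join x y) = meet x x;
  ql_join_idem : forall x y, join x (join y y) = join x y;
  ql_meet_idem : forall x y, meet x (meet y y) = meet x y;
  ql_join_meet_diag : forall x, join x x = meet x x
}.

Record distributive_quasi_lattice (T : Type) (join meet : T -> T -> T) : Prop :=
  DistributiveQuasiLattice {
  dql_quasi_lattice : quasi_lattice join meet;
  dql_joinDr : right_distributive join meet;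
  dql_meetDr : right_distributive meet join
}.

(* Algebras of type <2,2,1,0,0>; no axioms are imposed here. *)
Record algebra : Type := Algebra {
  carrier :> Type;
  join : carrier -> carrier -> carrier;
  meet : carrier -> carrier -> carrier;
  star : carrier -> carrier;
  zero : carrier;
  one : carrier
}.

Arguments zero : clear implicits.
Arguments one : clear implicits.

Record qb_algebra (Q : algebra) : Prop := QBAlgebra {
  qb_distributive : distributive_quasi_lattice (@join Q) (@meet Q);
  qb_join1 : forall x : Q, join x (one Q) = one Q;
  qb_meet0 : forall x : Q, meet x (zero Q) = zero Q;
  qb_join_star : forall x : Q, join x (star x) = one Q;
  qb_meet_star : forall x : Q, meet x (star x) = zero Q;
  qb_star_meet : forall x : Q, star (meet x x) = join (star x) (star x);
  qb_starK : involutive (@star Q)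
}.

Definition flat (Q : algebra) : Prop := one Q = zero Q.

Inductive term : Type :=
  | Var of nat
  | Join of term & term
  | Meet of term & term
  | Star of term
  | Zero
  | One.

Fixpoint eval (Q : algebra) (v : nat -> Q) (t : term) : Q :=
  match t with
  | Var n => v n
  | Join s u => join (eval v s) (eval v u)
  | Meet s u => meet (eval v s) (eval v u)
  | Star s => star (eval v s)
  | Zero => zero Q
  | One => one Q
  end.

Definition satisfies (Q : algebra) (p q : term) : Prop :=
  forall v : nat -> Q, eval v p = eval v q.

Inductive F3_carrier : Type := F3_0 | F3_c | F3_d.

Definition F3_star (x : F3_carrier) : F3_carrier :=
  match x with F3_0 => F3_0 | F3_c => F3_d | F3_d => F3_c end.

Definition F3 : algebra :=
  @Algebra F3_carrier (fun _ _ => F3_0) (fun _ _ => F3_0) F3_star F3_0 F3_0.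

Lemma F3_qb_algebra : qb_algebra F3.
Proof. by split=> //; case. Qed.

Lemma F3_flat : flat F3.
Proof. by []. Qed.

(* Main.v *)
(** In a flat QB-algebra absorption against [1 = 0] gives [x /\ x = 0], hence
    all joins and meets are [0], and [0* = 0].  So every term reduces to [0], to
    a variable, or to a starred variable, and the valuation of F3 sending one
    variable to [c] and all others to [0] separates these normal forms. *)
From mathcomp Require Import ssreflect ssrfun ssrbool eqtype ssrnat.
Require Import Defs.

Section FlatAlgebra.

Context {Q : algebra} (QQ : qb_algebra Q) (flatQ : flat Q).

Let quasiQ := dql_quasi_lattice (qb_distributive QQ).

Lemma flat_meetxx (x : Q) : meet x x = zero Q.
Proof. by rewrite -(ql_meet_join quasiQ x (one Q)) (qb_join1 QQ) flatQ (qb_meet0 QQ). Qed.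

Lemma flat_meet (x y : Q) : meet x y = zero Q.
Proof. by rewrite -(ql_meet_idem quasiQ) flat_meetxx (qb_meet0 QQ). Qed.

(** [join y y] equals [meet y y], hence [0], and [0 = 1] absorbs under join. *)
Lemma flat_join (x y : Q) : join x y = zero Q.
Proof.
by rewrite -(ql_join_idem quasiQ) (ql_join_meet_diag quasiQ) flat_meet -flatQ (qb_join1 QQ).
Qed.

(** As [0] is [meet 0 0], its star is a join, hence [0]. *)
Lemma flat_star0 : star (zero Q) = zero Q.
Proof. by rewrite -{1}(flat_meetxx (zero Q)) (qb_star_meet QQ) flat_join. Qed.

End FlatAlgebra.

(* [Some (b, n)] stands for the variable [n], starred when [b] holds, and
   [None] for [0]. *)
Fixpoint flat_nf (t : term) : option (bool * nat) :=
  match t with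
  | Var n => Some (false, n)
  | Star s => omap (fun l => (~~ l.1, l.2)) (flat_nf s)
  | _ => None
  end.

Definition eval_nf {Q : algebra} (v : nat -> Q) (l : option (bool * nat)) : Q :=
  if l is Some (b, n) then if b then star (v n) else v n else zero Q.

Lemma eval_flat_nf {Q : algebra} (v : nat -> Q) (t : term) :
  qb_algebra Q -> flat Q -> eval v t = eval_nf v (flat_nf t).
Proof.
move=> QQ flatQ; elim: t => //= [s _ u _|s _ u _|s ->].
- exact: flat_join.
- exact: flat_meet.
- case: (flat_nf s) => [[[] n]|] //=; first exact: qb_starK.
  exact: flat_star0.
Qed.

Lemma eval_nf_F3_inj (l m : option (bool * nat)) :
  (forall v : nat -> F3, eval_nf v l = eval_nf v m) -> l = m.
Proof.
pose point (n i : nat) : F3 := if i == n then F3_c else F3_0.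
case: l => [[b n]|]; case: m => [[b' n']|] // eq_lm.
- move: (eq_lm (point n)); rewrite /= /point eqxx.
  (* The left side is [c] or [d]. The right side is [0] if [n'] differs from [n]; otherwise [c]
     versus [d] detects the star. *)
  by case: eqVneq => [->|_]; case: b {eq_lm}; case: b'.
- by move: (eq_lm (point n)); rewrite /= /point eqxx; case: b {eq_lm}.
- by move: (eq_lm (point n')); rewrite /= /point eqxx; case: b' {eq_lm}.
Qed.

Theorem theorem4p1 (p q : term) :
  (forall Q : algebra, qb_algebra Q -> flat Q -> satisfies Q p q)
  <-> satisfies F3 p q.
Proof.
split=> [|eq_pq Q QQ flatQ v]; first by apply; [exact: F3_qb_algebra | exact: F3_flat].
(* Normal forms do not depend on [Q], so it is enough that [F3] determines them. *)
suff eq_nf: flat_nf p = flat_nf q by rewrite !eval_flat_nf // eq_nf.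
apply: eval_nf_F3_inj => v3.
have evalF3 t := eval_flat_nf v3 t F3_qb_algebra F3_flat.
by rewrite -!evalF3.
Qed.
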